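(* Let $G$ be a strongly regular graph with parameters $(n,k,a,c)$ such that $k$ is odd and $a$ and $c$ are even. Then the coefficients of the interlace polynomial $q(G,x)$ are all even.
   Context: Graphs are finite, undirected and simple with vertex set $\{1,\dots,n\}$. A graph is strongly regular with parameters $(n,k,a,c)$ if it has $n$ vertices, each vertex has degree $k$, $|N(i)\cap N(j)|=a$ for every two adjacent vertices $i,j$, and $|N(i)\cap N(j)|=c$ for every two distinct non-adjacent vertices $i,j$, where $N(i)$ is the neighborhood of $i$. Let $\Gamma$ be the adjacency matrix of $G$ over $\mathbb{F}_2$; for $\omega\subseteq\{1,\dots,n\}$ put $\Gamma[\omega]=(\Gamma_{ij})_{i,j\in\omega}$ and let $s(\Gamma[\omega])$ be the dimension of its kernel over $\mathbb{F}_2$, with $s(\Gamma[\emptyset])=0$. The interlace polynomial of $G$ is the integer polynomial $q(G,x)=\sum_{\omega\subseteq\{1,\dots,n\}}(x-1)^{s(\Gamma[\omega])}$. *)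

(* Defs.v *)
From mathcomp Require Import all_boot all_order all_algebra.

Set Implicit Arguments.
Unset Strict Implicit.
Unset Printing Implicit Defensive.

Import GRing.Theory.
Local Open Scope ring_scope.

Definition simple_graph (n : nat) (e : rel 'I_n) : Prop :=
  symmetric e /\ irreflexive e.

Definition neighborhood (n : nat) (e : rel 'I_n) (i : 'I_n) : {set 'I_n} :=
  [set j | e i j].

(* The conditions are taken literally: complete graphs, and disconnected
   graphs or graphs with disconnected complement, are not excluded. *)
Definition strongly_regular (n : nat) (e : rel 'I_n) (k a c : nat) : Prop :=
  [/\ forall i : 'I_n, #|neighborhood e i| = k,
      forall i j : 'I_n, e i j ->
        #|neighborhood e i :&: neighborhood e j| = a
    & forall i j : 'I_n, i != j -> ~~ e i j ->
        #|neighborhood e i :&: neighborhood e j| = c].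

Definition adjacency (n : nat) (e : rel 'I_n) : 'M['F_2]_n :=
  \matrix_(i, j) (e i j)%:R.

(* Rows and columns are indexed by the increasing enumeration of w. *)
Definition principal_submx (n : nat) (M : 'M['F_2]_n) (w : {set 'I_n}) :
    'M['F_2]_#|w| :=
  mxsub enum_val enum_val M.

(* kermx is the kernel acting on row vectors; it has the same dimension as
   the kernel on column vectors.  For m = 0 the value is 0. *)
Definition nullity (m : nat) (M : 'M['F_2]_m) : nat := \rank (kermx M).

Definition interlace_poly (n : nat) (e : rel 'I_n) : {poly int} :=
  \sum_(w : {set 'I_n})
    ('X - 1) ^+ nullity (principal_submx (adjacency e) w).

(* Main.v *)
(* Modulo 2 the strong regularity equations say that the adjacency matrix is its
   own inverse.  A principal submatrix of an invertible matrix has the same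
   nullity as the complementary principal submatrix of the inverse, so w and its
   complement contribute equal terms to the interlace polynomial, and
   complementation has no fixed point because n > 0. *)
Require Import Defs.
From mathcomp Require Import all_boot all_order all_algebra.

Import GRing.Theory.
Local Open Scope ring_scope.

Section ComplementaryNullity.

Variables (F : fieldType) (n : nat).
Implicit Types (M N : 'M[F]_n) (w : {set 'I_n}).

(** Its rows are the standard basis vectors indexed by [w]: right multiplication of a row vector by
    it extends by zero off [w], and by its transpose keeps only the coordinates in [w]. *)
Definition restriction_mx w : 'M[F]_(#|w|, n) := rowsub enum_val 1%:M.

Lemma mxsub_restriction M w w' :
  mxsub enum_val enum_val M =
    restriction_mx w *m M *m (restriction_mx w')^T :> 'M_(#|w|, #|w'|).
Proof.
rewrite /restriction_mx mul_rowsub_mx mul1mx trmx_mxsub trmx1.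
by rewrite mulmx_colsub mulmx1 -mxsubcr.
Qed.

Lemma restriction_mx_unit w : restriction_mx w *m (restriction_mx w)^T = 1%:M.
Proof.
rewrite -[X in X *m _]mulmx1 -mxsub_restriction.
by apply/matrixP=> i j; rewrite !mxE (inj_eq enum_val_inj).
Qed.

Lemma restriction_mx_disjoint w :
  restriction_mx w *m (restriction_mx (~: w))^T = 0.
Proof.
rewrite -[X in X *m _]mulmx1 -mxsub_restriction.
apply/matrixP=> i j; rewrite !mxE.
case: eqP => // ij; have := enum_valP j.
by rewrite inE -ij enum_valP.
Qed.

Lemma restriction_mx_proj w :
  (restriction_mx w)^T *m restriction_mx w =
    \matrix_(i, j) ((i == j) && (i \in w))%:R.
Proof.
apply/matrixP=> i j; rewrite !mxE.
under eq_bigr do rewrite !mxE.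
rewrite -(big_enum_val (fun k => (k == i)%:R * (k == j)%:R)) /=.
case: (boolP (i \in w)) => iw.
  rewrite (bigD1 i) //= eqxx mul1r big1 ?addr0 ?andbT // => k /andP[_ /negPf->].
  by rewrite mul0r.
rewrite andbF big1 // => k kw; case: eqP => [ki|_]; last by rewrite mul0r.
by rewrite -ki kw in iw.
Qed.

Lemma restriction_mx_complement w :
  (restriction_mx (~: w))^T *m restriction_mx (~: w) =
    1%:M - (restriction_mx w)^T *m restriction_mx w.
Proof.
rewrite !restriction_mx_proj; apply/matrixP=> i j; rewrite !mxE inE.
by case: (i == j); case: (i \in w); rewrite /= ?subrr ?subr0.
Qed.

(* If v is supported on w and v *m M vanishes on w, then v *m M is supported on
   the complement of w and (v *m M) *m N = v vanishes there. *)
Lemma leq_complementary_nullity M N w : M *m N = 1%:M ->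
  (\rank (kermx (mxsub enum_val enum_val M : 'M_#|w|)) <=
   \rank (kermx (mxsub enum_val enum_val N : 'M_#|~: w|)))%N.
Proof.
move=> MN; rewrite !mxsub_restriction.
set E := restriction_mx w; set E' := restriction_mx (~: w).
move: (kermx (E *m M *m E^T)) (mulmx_ker (E *m M *m E^T)) => K KM0.
rewrite !mulmxA in KM0.
(* The projection [E'^T *m E'] is [1%:M - E^T *m E]; by [KM0] the second term contributes nothing,
   and then [M *m N] cancels. *)
have cut p (G : 'M_(n, p)) :
    K *m E *m M *m E'^T *m (E' *m (N *m G)) = K *m (E *m G).
  rewrite -mulmxA (mulmxA E'^T) restriction_mx_complement mulmxBl mul1mx mulmxBr.
  by rewrite !mulmxA KM0 !mul0mx subr0 -(mulmxA _ M) MN mulmx1.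
apply: (@leq_trans (\rank (K *m E *m M *m E'^T))).
  (* Taking [G := E^T] in [cut] recovers [K], so passing to [K *m E *m M *m E'^T] loses no rank. *)
  have {1}-> : K = K *m E *m M *m E'^T *m (E' *m (N *m E^T)).
    by rewrite cut restriction_mx_unit mulmx1.
  exact: mxrankM_maxl.
(* With [G := E'^T], [cut] leaves [E *m E'^T], which is zero because the supports are disjoint. *)
apply/mxrankS/sub_kermxP.
by rewrite -[E' *m N *m _]mulmxA cut restriction_mx_disjoint mulmx0.
Qed.

Lemma complementary_nullity M N w : M *m N = 1%:M ->
  \rank (kermx (mxsub enum_val enum_val M : 'M_#|w|)) =
  \rank (kermx (mxsub enum_val enum_val N : 'M_#|~: w|)).
Proof.
move=> MN; apply/eqP; rewrite eqn_leq leq_complementary_nullity //=.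
(* For square matrices [N *m M = 1%:M] as well, so [M] and [N] may trade places, as may [w] and its
   complement. *)
have := leq_complementary_nullity _ _ (~: w) (mulmx1C MN).
by rewrite setCK.
Qed.

End ComplementaryNullity.

Lemma natr_F2 m : m%:R = (odd m)%:R :> 'F_2.
Proof. by rewrite -(Zp_nat_mod (isT : 1 < 2)%N) modn2. Qed.

Lemma adjacency_sqr n (e : rel 'I_n) i j : symmetric e ->
  (adjacency e *m adjacency e) i j =
    #|neighborhood e i :&: neighborhood e j|%:R.
Proof.
move=> sym_e; rewrite mxE -sum1_card natr_sum [RHS]big_mkcond /=.
apply: eq_bigr => k _; rewrite !mxE !inE (sym_e k j).
by case: (e i k); case: (e j k); rewrite ?mulr0 ?mulr1.
Qed.

Lemma adjacency_involutive n k a c (e : rel 'I_n) :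
    simple_graph e -> strongly_regular e k a c ->
    odd k -> ~~ odd a -> ~~ odd c ->
  adjacency e *m adjacency e = 1%:M.
Proof.
move=> [sym_e _] [deg adj nadj] k_odd /negPf a_even /negPf c_even.
apply/matrixP=> i j; rewrite adjacency_sqr // natr_F2 mxE.
have [<-|ij] := eqVneq i j; first by rewrite setIid deg k_odd.
have [eij|neij] := boolP (e i j); first by rewrite adj // a_even.
by rewrite nadj // c_even.
Qed.

(** Exactly one of [w] and [~: w] contains [x], so the sets containing [x] represent the
    complementary pairs once each. *)
Lemma sum_set_complement (T : finType) (V : nmodType) (x : T)
    (f : {set T} -> V) : (forall w, f (~: w) = f w) ->
  \sum_(w : {set T}) f w = (\sum_(w : {set T} | x \in w) f w) *+ 2.
Proof.
move=> fC; rewrite (bigID (fun w : {set T} => x \in w)) /= mulr2n; congr (_ + _).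
rewrite (reindex_inj (@setC_inj T)) /=.
by apply: eq_big => w; rewrite ?inE ?negbK.
Qed.

Theorem corollary8 (n k a c : nat) (e : rel 'I_n) (hn : (0 < n)%N)
    (he : simple_graph e) (hsr : strongly_regular e k a c)
    (hk : odd k) (ha : ~~ odd a) (hc : ~~ odd c) (i : nat) :
  (2 %| (interlace_poly e)`_i)%Z.
Proof.
have inv_e := adjacency_involutive _ _ _ _ _ he hsr hk ha hc.
(* The point that selects one set from each pair is the first vertex, which exists by [hn]. *)
rewrite /interlace_poly (sum_set_complement _ _ (Ordinal hn)) => [|w].
  by rewrite coefMn -[_ *+ 2]mulr_natr; apply: dvdz_mull.
by rewrite /nullity /principal_submx -(complementary_nullity _ _ _ _ w inv_e).
Qed.
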